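(* Let $H$ be a real Hilbert space, let $D\subseteq H$ be a nonempty closed convex set, let $I$ be a countable set of positive integers, and let $(T_i)_{i\in I}$ be firmly nonexpansive operators $T_i:D\to D$ with $F:=\bigcap_{i\in I}\mathrm{Fix}(T_i)\neq\emptyset$. Let $(\Omega,w)\in\mathcal{M}_\infty$, let $(\lambda_k)_{k\in\mathbb{N}}$ be a steering sequence, and let $u,x^0\in D$. Then the sequence defined by $$x^{k+1}=\lambda_k u+(1-\lambda_k)\sum_{t\in\Omega}w(t)T[t](x^k),\quad k\ge0,$$ is well defined and converges strongly to $P_F(u)$.
   Context: An operator $T:D\to H$ is firmly nonexpansive if $\|T(x)-T(y)\|^2\le\langle x-y,T(x)-T(y)\rangle$ for all $x,y\in D$. $\mathrm{Fix}(T)=\{x\in D:T(x)=x\}$; $P_F$ is the metric projection onto $F$. An index vector is a finite tuple $t=(t_1,\dots,t_q)$ with each $t_\ell\in I$; the string operator is $T[t]:=T_{t_q}T_{t_{q-1}}\cdots T_{t_1}$. A countable set $\Omega$ of index vectors is fit if every $i\in I$ appears as a component of some $t\in\Omega$. $\mathcal{M}_\infty$ denotes the collection of all pairs $(\Omega,w)$ where $\Omega$ is a fit countable set of index vectors and $w:\Omega\to(0,1)$ satisfies $\sum_{t\in\Omega}w(t)=1$. A steering sequence is a real sequence $(\lambda_k)_{k\in\mathbb{N}}$ with $\lambda_k\in[0,1]$ for all $k$, $\lim_{k\to\infty}\lambda_k=0$, $\sum_{k=0}^\infty\lambda_k=+\infty$, and $\sum_{k=0}^\infty|\lambda_{k+1}-\lambda_k|<\infty$.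 *)

(* Defs.v *)
From HB Require Import structures.
From mathcomp Require Import all_boot all_order all_algebra.
From mathcomp Require Import all_classical all_reals all_analysis.
Set Implicit Arguments. Unset Strict Implicit. Unset Printing Implicit Defensive.
Import Order.TTheory GRing.Theory Num.Theory.
Import numFieldNormedType.Exports.
Local Open Scope classical_set_scope.
Local Open Scope ring_scope.

Section Defs.
Variables (R : realType) (H : normedModType R).

Definition inner_product_of_norm (ip : H -> H -> R) : Prop :=
  [/\ forall x y, ip x y = ip y x,
      forall a x y z, ip (a *: x + y) z = a * ip x z + ip y z
    & forall x, ip x x = `|x| ^+ 2].

Definition convex_subset (D : set H) : Prop :=
  forall x y (t : R), D x -> D y -> 0 <= t -> t <= 1 ->
    D (t *: x + (1 - t) *: y).

Definition firmly_nonexpansive_on (ip : H -> H -> R) (D : set H) (T : H -> H) :=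
  forall x y, D x -> D y -> `|T x - T y| ^+ 2 <= ip (x - y) (T x - T y).

Definition Fix (D : set H) (T : H -> H) : set H := [set x | D x /\ T x = x].

(* string operator T[t] = T_{t_q} ... T_{t_1} : t_1 is applied first *)
Definition string_op (T : nat -> H -> H) (t : seq nat) (x : H) : H :=
  foldl (fun y i => T i y) x t.

Definition index_vector (I : set nat) (t : seq nat) : Prop :=
  (0 < size t)%N /\ forall i, i \in t -> I i.

Definition fit (I : set nat) (Om : set (seq nat)) : Prop :=
  (forall t, Om t -> index_vector I t) /\
  forall i, I i -> exists t, Om t /\ i \in t.

(* (Omega, w) in M_infty; Omega is a subset of the countable type seq nat,
   hence countable *)
Definition M_infty (I : set nat) (Om : set (seq nat)) (w : seq nat -> R) : Prop :=
  [/\ fit I Om,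
      forall t, Om t -> 0 < w t /\ w t < 1
    & (\esum_(t in Om) (w t)%:E = 1)%E].

(* unconditional (net of finite subsets) convergence of a countable sum in H *)
Definition HasSum (Om : set (seq nat)) (g : seq nat -> H) (s : H) : Prop :=
  forall e : R, 0 < e -> exists S0 : seq (seq nat),
    [/\ uniq S0, (forall t, t \in S0 -> Om t) &
      forall S : seq (seq nat), uniq S -> (forall t, t \in S -> Om t) ->
        {subset S0 <= S} -> `| s - \sum_(t <- S) g t | < e].

Definition steering (lam : nat -> R) : Prop :=
  [/\ forall k, 0 <= lam k /\ lam k <= 1,
      lam @ \oo --> 0,
      (fun n => \sum_(0 <= k < n) lam k) @ \oo --> +oo
    & cvg (series (fun k => `|lam k.+1 - lam k|) @ \oo)].

Definition metric_projection (F : set H) (u p : H) : Prop :=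
  F p /\ forall y, F y -> `|u - p| <= `|u - y|.

End Defs.

(* Main.v *)
(** The weighted string average S x = sum_t w(t) T[t](x) is a nonexpansive self-map
of D. Its fixed points are exactly F: if S x = x and q is in F, then x - q is a
strictly weighted average of vectors of norm at most |x - q|, so each T[t](x) is
x, and firm nonexpansiveness propagates this to every factor of T[t]. The
iteration is therefore a Halpern iteration for S.

The Browder points z_s = s u + (1 - s) S z_s converge as s tends to 0 to a fixed
point p of S satisfying <u - p, p - y> >= 0 on F, that is p = P_F(u). The
iterates satisfy |x_{k+1} - x_k| -> 0, hence |x_k - S x_k| -> 0; comparing x_k
with z_s through the monotonicity of id - S gives limsup <u - p, x_k - p> <= 0,
and the recursion for |x_k - p|^2 forces x_k -> p (Wittmann). *)

Require Import Defs.
From HB Require Import structures.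
From mathcomp Require Import all_boot all_order all_algebra.
From mathcomp Require Import all_classical all_reals all_analysis.
From mathcomp Require Import ring lra.
Set Implicit Arguments. Unset Strict Implicit. Unset Printing Implicit Defensive.
Import Order.TTheory GRing.Theory Num.Theory.
Import numFieldNormedType.Exports.
Local Open Scope classical_set_scope.
Local Open Scope ring_scope.

(** * Convergence criteria in normed spaces *)

Lemma cvg_seq_distP (R : realType) (V : normedModType R) (v : nat -> V) (l : V) :
  v @ \oo --> l <->
  forall e : R, 0 < e -> exists N, forall n, (N <= n)%N -> `|v n - l| <= e.
Proof.
split=> [/cvgrPdist_le h e /h[N _ hN]|h].
  by exists N => n /hN /=; rewrite distrC.
apply/cvgrPdist_le => e /h[N hN]; exists N => // n /hN.
by rewrite distrC.
Qed.

Lemma cauchy_seq_cvg (R : realType) (V : completeNormedModType R) (v : nat -> V) :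
  (forall e : R, 0 < e ->
     exists N, forall m n, (N <= m)%N -> (N <= n)%N -> `|v m - v n| <= e) ->
  exists l : V, v @ \oo --> l.
Proof.
move=> h; suff : cvg (v @ \oo) by move=> vl; exists (lim (v @ \oo)).
apply/cauchy_cvgP/cauchy_exP => e e0.
have [N hN] := h (e / 2) (divr_gt0 e0 (ltr0Sn _ _)).
exists (v N); exists N => // n Nn.
rewrite -ball_normE /=; apply: le_lt_trans (hN _ _ (leqnn N) Nn) _.
lra.
Qed.

Lemma closed_approx (R : realType) (V : normedModType R) (D : set V) (s : V) :
  closed D -> (forall e : R, 0 < e -> exists2 y, D y & `|s - y| < e) -> D s.
Proof.
move=> cD h; apply: cD => B /nbhs_ballP[e /= e0 eB].
have [y Dy ys] := h e e0; exists y; split => //.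
by apply: eB; rewrite -ball_normE.
Qed.

(** * A recursive inequality for real sequences *)

(** The induction rests on [(1 - l) * (1 + S + l) = 1 + S - l * (S + l)]. A diverging sum thus
    drives the product to 0, with an explicit rate and no exponentials. *)
Lemma prod_compl_le (R : realType) (lam : nat -> R) (N n : nat) :
  (forall k, 0 <= lam k <= 1) ->
  0 <= \prod_(N <= k < N + n) (1 - lam k) /\
  (\prod_(N <= k < N + n) (1 - lam k)) *
     (1 + \sum_(N <= k < N + n) lam k) <= 1.
Proof.
move=> h; elim: n => [|n [IH1 IH2]].
  by rewrite addn0 !big_geq // addr0 mulr1.
have /andP[l0 l1] := h (N + n)%N.
have S0 : 0 <= \sum_(N <= k < N + n) lam k.
  by apply: sumr_ge0 => k _; case/andP: (h k).
rewrite addnS !big_nat_recr ?leq_addr //=.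
move: IH1 IH2 S0; set P := \prod_(_ <= _ < _) _; set S := \sum_(_ <= _ < _) _.
move=> P0 PS S0; split; first by apply: mulr_ge0 => //; rewrite subr_ge0.
apply: le_trans PS; rewrite -mulrA; apply: ler_wpM2l => //.
nra.
Qed.

(* With e bounding b and the tail of c from N on, a - e - (partial sums of c)
   contracts by the factor 1 - lam at each step. *)
Lemma halpern_recursion_cvg0 (R : realType) (lam a b c : nat -> R) :
  (forall k, 0 <= lam k <= 1) ->
  (forall A : R, exists N, forall n, (N <= n)%N -> A <= \sum_(0 <= k < n) lam k) ->
  (forall k, 0 <= c k) ->
  (forall e : R, 0 < e -> exists N, forall n, \sum_(N <= k < N + n) c k <= e) ->
  (forall e : R, 0 < e -> exists N, forall n, (N <= n)%N -> b n <= e) ->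
  (forall k, a k.+1 <= (1 - lam k) * a k + lam k * b k + c k) ->
  forall e : R, 0 < e -> exists N, forall n, (N <= n)%N -> a n <= e.
Proof.
move=> hl hdiv c0 hc hb ha e e0.
have e30 : 0 < e / 3 by lra.
have [N1 hN1] := hb _ e30; have [N2 hN2] := hc _ e30.
pose N := maxn N1 N2.
have cN n : \sum_(N <= k < N + n) c k <= e / 3.
  apply: le_trans (hN2 (N - N2 + n)%N).
  rewrite addnA subnKC ?leq_maxr// (@big_cat_nat _ _ _ N N2) ?leq_maxr ?leq_addr //=.
  by rewrite lerDr sumr_ge0.
have step n : a (N + n)%N - e / 3 - \sum_(N <= k < N + n) c k <=
    (\prod_(N <= k < N + n) (1 - lam k)) * `|a N|.
  elim: n => [|n IH].
    rewrite addn0 !big_geq // mul1r subr0.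
    by have := ler_norm (a N); lra.
  have S0 : 0 <= \sum_(N <= k < N + n) c k by apply: sumr_ge0.
  have /andP[l0 l1] := hl (N + n)%N.
  rewrite addnS !big_nat_recr ?leq_addr //=.
  have bn : b (N + n)%N <= e / 3.
    by apply: hN1; rewrite (leq_trans (leq_maxl N1 N2)) ?leq_addr.
  have := ha (N + n)%N.
  rewrite mulrAC.
  move: IH S0 bn; set A := (\prod_(_ <= _ < _) _ * _); set S := \sum_(_ <= _ < _) _.
  move=> IH S0 bn h.
  have : (1 - lam (N + n)%N) * (a (N + n)%N - e / 3 - S) <= (1 - lam (N + n)%N) * A.
    by apply: ler_wpM2l => //; lra.
  have : lam (N + n)%N * b (N + n)%N <= lam (N + n)%N * (e / 3).
    by apply: ler_wpM2l.
  have : 0 <= lam (N + n)%N * S by apply: mulr_ge0.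
  lra.
pose S0 := \sum_(0 <= k < N) lam k.
(* Beyond this threshold the sum of [lam] from [N] on is at least [|a N| / (e / 3)], so
   [prod_compl_le] bounds the product times [|a N|] by the last third of [e]. *)
have [N3 hN3] := hdiv (S0 + `|a N| / (e / 3)).
exists (N + N3)%N => n hn.
have -> : n = (N + (n - N))%N by rewrite subnKC // (leq_trans _ hn) // leq_addr.
set m := (n - N)%N.
have [P0 PS] := prod_compl_le N m hl.
have : S0 + `|a N| / (e / 3) <= S0 + \sum_(N <= k < N + m) lam k.
  rewrite -big_cat_nat ?leq_addr //=.
  apply: hN3; rewrite /m; rewrite subnKC ?(leq_trans _ hn) ?leq_addl // leq_addr//.
rewrite lerD2l ler_pdivrMr // => hA.
have := step m; have := cN m.
move: P0 PS hA; set P := \prod_(_ <= _ < _) _; set S := \sum_(_ <= _ < _) lam _.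
move=> P0 PS hA hc1 h1.
have : P * `|a N| <= P * (S * (e / 3)) by apply: ler_wpM2l.
have : P * (1 + S) * (e / 3) <= 1 * (e / 3) by apply: ler_wpM2r => //; lra.
have : 0 <= P * (e / 3) by apply: mulr_ge0 => //; lra.
lra.
Qed.

(** * Inner product calculus *)

Section InnerProduct.
Variables (R : realType) (H : normedModType R) (ip : H -> H -> R).
Hypothesis ipP : inner_product_of_norm ip.

Lemma ipC x y : ip x y = ip y x. Proof. by case: ipP. Qed.
Lemma ip_norm x : ip x x = `|x| ^+ 2. Proof. by case: ipP. Qed.
Lemma ipDl x y z : ip (x + y) z = ip x z + ip y z.
Proof. by case: ipP => _ h _; have := h 1 x y z; rewrite scale1r mul1r. Qed.
Lemma ip0l z : ip 0 z = 0.
Proof. by apply: (addrI (ip 0 z)); rewrite -ipDl !addr0. Qed.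
Lemma ipZl a x z : ip (a *: x) z = a * ip x z.
Proof. by case: ipP => _ h _; have := h a x 0 z; rewrite addr0 ip0l addr0. Qed.
Lemma ipNl x z : ip (- x) z = - ip x z.
Proof. by rewrite -scaleN1r ipZl mulN1r. Qed.
Lemma ipBl x y z : ip (x - y) z = ip x z - ip y z.
Proof. by rewrite ipDl ipNl. Qed.
Lemma ipDr x y z : ip z (x + y) = ip z x + ip z y.
Proof. by rewrite ipC ipDl !(ipC _ z). Qed.
Lemma ipZr a x z : ip z (a *: x) = a * ip z x.
Proof. by rewrite ipC ipZl ipC. Qed.
Lemma ipNr x z : ip z (- x) = - ip z x.
Proof. by rewrite ipC ipNl ipC. Qed.
Lemma ip_suml (J : Type) (r : seq J) (f : J -> H) z :
  ip (\sum_(j <- r) f j) z = \sum_(j <- r) ip (f j) z.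
Proof.
by elim: r => [|j r IH]; rewrite ?big_nil ?ip0l // !big_cons ipDl IH.
Qed.

Definition ipE := (ipDl, ipDr, ipNl, ipNr, ipZl, ipZr).

(** Testing against all [z] turns linear identities between vectors into scalar identities that
    [ring] can settle. *)
Lemma ip_ext x y : (forall z, ip x z = ip y z) -> x = y.
Proof.
move=> h; apply/eqP; rewrite -subr_eq0 -normr_eq0 -sqrf_eq0 -ip_norm.
by rewrite ipBl h subrr.
Qed.

Lemma normD_sqr x y : `|x + y| ^+ 2 = `|x| ^+ 2 + 2 * ip x y + `|y| ^+ 2.
Proof. by rewrite -!ip_norm !ipE (ipC y x); ring. Qed.

Lemma normB_sqr x y : `|x - y| ^+ 2 = `|x| ^+ 2 - 2 * ip x y + `|y| ^+ 2.
Proof. by rewrite normD_sqr normrN ipNr mulrN. Qed.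

(** Cauchy-Schwarz comes from the triangle inequality already available for the norm: square it and
    compare with the expansion of [|x + y| ^+ 2]. *)
Lemma ip_le_norm x y : ip x y <= `|x| * `|y|.
Proof.
have := ler_normD x y; have := normD_sqr x y.
have := normr_ge0 x; have := normr_ge0 y; have := normr_ge0 (x + y).
nra.
Qed.

End InnerProduct.

Lemma le0_of_le_eps (R : realType) (K x : R) :
  0 <= K -> (forall e : R, 0 < e -> x <= K * e) -> x <= 0.
Proof.
move=> K0 h; apply/ler_addgt0Pr => e e0; rewrite add0r.
have K1 : 0 < K + 1 by lra.
apply: le_trans (h (e / (K + 1)) (divr_gt0 e0 K1)) _.
rewrite mulrA ler_pdivrMr //; nra.
Qed.

(** * Browder points of a nonexpansive map and their limit *)

Section Halpern.
Variables (R : realType) (H : completeNormedModType R) (ip : H -> H -> R).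
Variables (D : set H) (S : H -> H) (u q : H).
Hypothesis ipP : inner_product_of_norm ip.
Hypotheses (cD : closed D) (cvD : convex_subset D).
Hypothesis SD : forall x, D x -> D (S x).
Hypothesis Sne : forall x y, D x -> D y -> `|S x - S y| <= `|x - y|.
Hypotheses (Du : D u) (Dq : D q) (Sq : S q = q).

Lemma nonexpansive_monotone x y : D x -> D y ->
  0 <= ip ((x - S x) - (y - S y)) (x - y).
Proof.
move=> Dx Dy.
have -> : (x - S x) - (y - S y) = (x - y) - (S x - S y).
  by rewrite !opprD !opprK addrACA.
rewrite (ipBl ipP) (ip_norm ipP).
have := ip_le_norm ipP (S x - S y) (x - y); have := Sne Dx Dy.
have := normr_ge0 (x - y); nra.
Qed.

Definition browder_point (s : R) (z : H) :=
  [/\ 0 < s < 1, D z & z = s *: u + (1 - s) *: S z].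

(** The map [f] contracts the closed set [D] with ratio [1 - s], and convexity keeps it in [D], so
    Banach's theorem applies. *)
Lemma browder_point_exists s : 0 < s < 1 -> exists z, browder_point s z.
Proof.
move=> s01; have /andP[s0 s1] := s01.
pose f x := s *: u + (1 - s) *: S x.
have fD : {homo f : x / D x >-> D x}.
  by move=> x Dx; apply: cvD => //; [exact: SD|exact: ltW|exact: ltW].
have q0 : 0 <= 1 - s by lra.
have ctr : is_contraction (mkfun_fun fD).
  exists (NngNum q0); split => /=; first by lra.
  move=> [x y] /= [Dx Dy]; rewrite /f addrAC opprD addrA subrr add0r.
  rewrite [X in `|X|]addrC -scalerBr normrZ ger0_norm //.
  by apply: ler_wpM2l => //; exact: Sne.
have [z Dz zE] := banach_fixed_point ctr cD (ex_intro _ _ Du).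
by exists z; split.
Qed.

Section BrowderPoint.
Variables (s : R) (z : H).
Hypothesis zP : browder_point s z.

Lemma browder_point_residual : z - S z = s *: (u - S z).
Proof.
case: zP => _ _ zE; rewrite {1}zE scalerBl scale1r scalerBr.
by rewrite -addrA; congr (_ + _); rewrite addrAC subrr add0r.
Qed.

Lemma browder_point_residual' : (1 - s) *: (z - S z) = s *: (u - z).
Proof.
rewrite scalerBl scale1r {1}browder_point_residual -scalerBr.
by rewrite opprB addrA subrK.
Qed.

(** Monotonicity of id - S at [z] and [y], with the residual of [z] expressed through [u - z]. It is
    applied to other Browder points, to fixed points and to the iterates. *)
Lemma browder_point_ip y : D y ->
  (1 - s) * ip (y - S y) (z - y) <= s * ip (u - z) (z - y).
Proof.
move=> Dy; case: (zP) => /andP[s0 s1] Dz _.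
rewrite -(ipZl ipP s) -browder_point_residual' (ipZl ipP).
apply: ler_wpM2l; first by lra.
by have := nonexpansive_monotone Dz Dy; rewrite (ipBl ipP (z - S z)) subr_ge0.
Qed.

Lemma browder_point_bound : `|z - q| <= `|u - q|.
Proof.
case: zP => /andP[s0 s1] Dz zE.
have : `|z - q| <= s * `|u - q| + (1 - s) * `|z - q|.
  have {1}-> : z - q = s *: (u - q) + (1 - s) *: (S z - q).
    rewrite {1}zE !scalerBr addrACA -opprD -scalerDl (_ : s + (1 - s) = 1) ?scale1r //.
    by rewrite addrC subrK.
  apply: le_trans (ler_normD _ _) _; rewrite !normrZ !ger0_norm; try lra.
  rewrite lerD2l; apply: ler_wpM2l; first by lra.
  by rewrite -{1}Sq; apply: Sne.
nra.
Qed.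

Lemma browder_point_bound' : `|u - z| <= 2 * `|u - q|.
Proof.
have := browder_point_bound; have := ler_distD q u z.
by rewrite (distrC q z); lra.
Qed.

End BrowderPoint.

(* The monotonicity of id - S makes |u - z_s|^2 monotone in s and dominates
   |z_s - z_r|^2 by its increments, so no weak compactness is needed. *)
Lemma browder_point_increment s r z y :
  browder_point s z -> browder_point r y -> s <= r ->
  `|z - y| ^+ 2 <= `|u - z| ^+ 2 - `|u - y| ^+ 2.
Proof.
move=> zP yP sr; have [/andP[s0 s1] Dz _] := zP; have [/andP[r0 r1] Dy _] := yP.
have := browder_point_ip zP Dy.
have e1 : (1 - r) * ip (y - S y) (z - y) = r * ip (u - y) (z - y).
  by rewrite -!(ipZl ipP) (browder_point_residual' yP).
set A := ip (u - z) (z - y); set B := ip (u - y) (z - y).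
have eAB : A = B - `|z - y| ^+ 2.
  rewrite /A /B -(ip_norm ipP) -(ipBl ipP); congr (ip _ _).
  by rewrite opprB addrA subrK.
have eB : `|u - z| ^+ 2 = `|u - y| ^+ 2 - 2 * B + `|z - y| ^+ 2.
  rewrite -(normB_sqr ipP); congr (`|_| ^+ 2).
  by rewrite opprB addrA subrK.
have d0 : 0 <= `|z - y| ^+ 2 by exact: sqr_ge0.
rewrite eB eAB => h.
suff : B <= 0 by lra.
(* Multiplying by [1 - r] replaces the residual of [y] by [u - y]. As
   [(1 - s) * r - s * (1 - r) = r - s], collecting the terms in [B] gives [h3]. *)
have h2 : (1 - s) * (r * B) <= s * (B - `|z - y| ^+ 2) * (1 - r).
  by rewrite -e1 mulrCA mulrC; apply: ler_wpM2r => //; lra.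
have h3 : (r - s) * B <= - (s * (1 - r) * `|z - y| ^+ 2) by nra.
(* For [s = r] there is nothing to divide by, but [h3] then forces [z = y] and hence [B = 0]. *)
move: sr; rewrite le_eqVlt => /orP[/eqP srE|sr].
  have d00 : `|z - y| ^+ 2 = 0.
    have : s * (1 - r) * `|z - y| ^+ 2 <= 0 by move: h3; rewrite srE subrr mul0r; lra.
    have : 0 < s * (1 - r) by apply: mulr_gt0; lra.
    nra.
  have /eqP : z - y = 0 by apply/eqP; rewrite -normr_eq0 -sqrf_eq0 d00.
  by rewrite /B => /eqP ->; rewrite (ipC ipP) (ip0l ipP).
have : (r - s) * B <= 0.
  apply: le_trans h3 _; rewrite oppr_le0; apply: mulr_ge0 => //.
  by apply: mulr_ge0; lra.
by rewrite pmulr_rle0 // subr_gt0.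
Qed.

(** Along parameters decreasing to 0, [|u - z| ^+ 2] increases and is bounded; its convergence makes
    the Browder points Cauchy. The limit inherits the fixed-point equation and the variational
    inequality. *)
Lemma browder_limit : exists p : H,
  [/\ D p, S p = p, forall y, D y -> S y = y -> 0 <= ip (u - p) (p - y) &
    forall e : R, 0 < e -> exists s z, browder_point s z /\ `|z - p| <= e].
Proof.
(* The shift by two keeps every parameter strictly below 1, including the one at [n = 0]. *)
pose s n : R := n.+2%:R^-1.
have s01 n : 0 < s n < 1.
  by rewrite invr_gt0 ltr0n /= invf_lt1 ?ltr0n // ltr1n.
have /choice[z zP] : forall n, exists z, browder_point (s n) z.
  by move=> n; exact: browder_point_exists.
have sle m n : (n <= m)%N -> s m <= s n.
  by move=> nm; rewrite lef_pV2 ?posrE ?ltr0n // ler_nat.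
have inc m n (nm : (n <= m)%N) :=
  browder_point_increment (zP m) (zP n) (sle _ _ nm).
pose b n := `|u - z n| ^+ 2.
have /cvg_ex[/= l bl] : cvg (b @ \oo).
  apply: nondecreasing_is_cvgn.
    move=> n m nm; rewrite /b; have := inc _ _ nm; have := sqr_ge0 `|z m - z n|.
    by lra.
  exists ((2 * `|u - q|) ^+ 2) => _ [n _ <-]; rewrite /b.
  by rewrite ler_sqr ?nnegrE ?mulr_ge0 // (browder_point_bound' (zP n)).
have [p zp] : exists p : H, z @ \oo --> p.
  apply: cauchy_seq_cvg => e e0.
  (* Two terms of [b] within [e ^+ 2 / 2] of [l] differ by at most [e ^+ 2], which bounds the
     squared distance of the points. *)
  have [N hN] := (cvg_seq_distP b l).1 bl (e ^+ 2 / 2)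
    (divr_gt0 (exprn_gt0 2 e0) (ltr0Sn _ _)).
  exists N => m n; wlog nm : m n / (n <= m)%N.
    move=> h Nm Nn; case: (leqP n m) => [nm|/ltnW mn]; first exact: h.
    by rewrite distrC; exact: h.
  move=> Nm Nn; rewrite -ler_sqr ?nnegrE ?(ltW e0) //.
  have := inc _ _ nm; have := hN _ Nm; have := hN _ Nn.
  rewrite -/(b m) -/(b n) !ler_norml => /andP[h1 h2] /andP[h3 h4] h5; lra.
have Dp : D p.
  apply: closed_cvg zp => //; apply: nearW => n; by case: (zP n).
have zpe e : 0 < e -> exists N, forall n, (N <= n)%N -> `|z n - p| <= e.
  by move: e; apply/cvg_seq_distP.
exists p; split => //.
- apply/eqP; rewrite eq_sym -subr_eq0 -normr_le0.
  (* Going from [p] to [S p] through [z n] and [S (z n)] costs [e] twice, plus the residual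
     [s n * |u - S (z n)|]. *)
  apply: (@le0_of_le_eps _ (2 + 2 * `|u - q|)).
    by apply: addr_ge0 => //; apply: mulr_ge0.
  move=> e e0; have [N hN] := zpe _ e0.
  have [M hM] : exists M, forall n, (M <= n)%N -> s n <= e.
    have [M hM] := (cvg_seq_distP _ _).1 (@cvg_harmonic R) _ e0.
    exists M => n Mn; have := hM n.+1 (leqW Mn); rewrite /harmonic subr0.
    by apply: le_trans; exact: ler_norm.
  pose n := maxn N M.
  have := hN n (leq_maxl _ _); have := hM n (leq_maxr _ _) => h1 h2.
  have [/andP[s0 s1] Dz _] := zP n.
  have := ler_distD (z n) p (S p); have := ler_distD (S (z n)) (z n) (S p).
  have := Sne Dz Dp; rewrite (distrC p (z n)).
  rewrite (browder_point_residual (zP n)) normrZ gtr0_norm // => h3 h4 h5.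
  have : `|u - S (z n)| <= 2 * `|u - q|.
    have := ler_distD q u (S (z n)); have := Sne Dq Dz; rewrite Sq (distrC q (z n)).
    by have := browder_point_bound (zP n); lra.
  have := normr_ge0 (u - q); have := normr_ge0 (u - S (z n)); nra.
- move=> y Dy Sy; rewrite -oppr_le0.
  apply: (@le0_of_le_eps _ (`|p - y| + 2 * `|u - q|)).
    by apply: addr_ge0 => //; apply: mulr_ge0.
  move=> e e0; have [N hN] := zpe _ e0.
  have := hN N (leqnn _).
  have [/andP[s0 s1] Dz _] := zP N.
  have := browder_point_ip (zP N) Dy.
  rewrite Sy subrr (ip0l ipP) mulr0 pmulr_rge0 // => h1 h2.
  (* Replace [p] by [z N]: the first term is nonpositive by [h1], and the other two are controlled
     by [|z N - p|]. *)
  have -> : - ip (u - p) (p - y) =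
    - ip (u - z N) (z N - y) + ip (p - z N) (p - y) + ip (u - z N) (z N - p).
    by rewrite !(ipE ipP); ring.
  have := ip_le_norm ipP (p - z N) (p - y).
  have := ip_le_norm ipP (u - z N) (z N - p).
  have := browder_point_bound' (zP N).
  rewrite (distrC p (z N)).
  have := normr_ge0 (u - q); have := normr_ge0 (u - z N); have := normr_ge0 (p - y).
  have := normr_ge0 (z N - p).
  move: h1 h2; set a := ip _ _; set b1 := ip _ _; set b2 := ip _ _; nra.
- move=> e /zpe[N hN]; exists (s N), (z N); split => //; exact: hN.
Qed.

(** * The Halpern iteration *)

Lemma steering_tail (lam : nat -> R) : steering lam ->
  forall e : R, 0 < e ->
  exists N, forall n, \sum_(N <= k < N + n) `|lam k.+1 - lam k| <= e.
Proof.
case=> _ _ _ /cvg_ex[/= l hl] e e0.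
have [N hN] := (cvg_seq_distP _ _).1 hl _ (divr_gt0 e0 (ltr0Sn _ 1)).
exists N => n; rewrite -sub_series_geq ?leq_addr //.
have := hN _ (leqnn N); have := hN _ (leq_addr n N).
by rewrite !ler_norml => /andP[h1 h2] /andP[h3 h4]; lra.
Qed.

(** Dropping [lam 0] costs at most 1. The recursion for successive differences of iterates runs with
    the shifted parameters. *)
Lemma steering_shift_diverges (lam : nat -> R) : steering lam ->
  forall A : R, exists N, forall n, (N <= n)%N ->
    A <= \sum_(0 <= k < n) lam k.+1.
Proof.
case=> /(_ 0%N)[_ l1] _ /cvgryPge h _ A; have [N _ hN] := h (A + 1).
exists N => n Nn; have := hN n.+1 (leqW Nn); rewrite /= big_nat_recl //=; lra.
Qed.

Section Iteration.
Variables (lam : nat -> R) (x : nat -> H).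
Hypothesis lamP : steering lam.
Hypothesis Dx0 : D (x 0%N).
Hypothesis xS : forall k, x k.+1 = lam k *: u + (1 - lam k) *: S (x k).

Let lam01 k : 0 <= lam k <= 1.
Proof. by case: lamP => /(_ k)[-> ->]. Qed.

Lemma halpern_iter_in k : D (x k).
Proof.
elim: k => // k IH; rewrite xS; have /andP[l0 l1] := lam01 k.
by apply: cvD => //; exact: SD.
Qed.

Let K := `|x 0%N - q| + `|u - q|.

Let K0 : 0 <= K. Proof. exact: addr_ge0. Qed.

Lemma halpern_iter_bound k : `|x k - q| <= K.
Proof.
elim: k => [|k IH]; first by rewrite lerDl.
have /andP[l0 l1] := lam01 k.
have -> : x k.+1 - q = lam k *: (u - q) + (1 - lam k) *: (S (x k) - q).
  by rewrite xS; apply: (ip_ext ipP) => z; rewrite !(ipE ipP); ring.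
apply: le_trans (ler_normD _ _) _; rewrite !normrZ !ger0_norm ?subr_ge0 //.
have : `|S (x k) - q| <= `|x k - q|.
  by rewrite -{1}Sq; exact: Sne (halpern_iter_in k) Dq.
have : `|u - q| <= K by rewrite lerDr.
by nra.
Qed.

Lemma halpern_iter_anchor_bound k : `|u - S (x k)| <= 2 * K.
Proof.
have := ler_distD q u (S (x k)); have := Sne Dq (halpern_iter_in k).
rewrite Sq (distrC q (x k)); have := halpern_iter_bound k.
have : `|u - q| <= K by rewrite lerDr.
by lra.
Qed.

(** Subtracting two consecutive steps leaves a contraction by [1 - lam k.+1] and a perturbation of
    size at most [2 * K * |lam k.+1 - lam k|], which is summable. *)
Lemma halpern_iter_asymptotic_regularity (e : R) : 0 < e ->
  exists N, forall n, (N <= n)%N -> `|x n.+1 - x n| <= e.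
Proof.
move: e; apply: (@halpern_recursion_cvg0 _ (fun k => lam k.+1)
  (fun n => `|x n.+1 - x n|) (fun=> 0) (fun k => 2 * K * `|lam k.+1 - lam k|)).
- by move=> k; exact: lam01.
- exact: steering_shift_diverges.
- by move=> k; rewrite !mulr_ge0.
- move=> e e0.
  (* The added 1 keeps the divisor positive, since [K] may vanish. *)
  have K1 : 0 < 2 * K + 1 by have := K0; lra.
  have [N hN] := steering_tail lamP (divr_gt0 e0 K1); exists N => n.
  rewrite -mulr_sumr; have := hN n; rewrite ler_pdivlMr //.
  have : 0 <= \sum_(N <= k < N + n) `|lam k.+1 - lam k| by apply: sumr_ge0.
  by lra.
- by move=> e e0; exists 0%N => n _; exact: ltW.
move=> k; rewrite mulr0 addr0.
have -> : x k.+2 - x k.+1 = (1 - lam k.+1) *: (S (x k.+1) - S (x k)) +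
    (lam k.+1 - lam k) *: (u - S (x k)).
  rewrite (xS k.+1) {2}(xS k).
  by apply: (ip_ext ipP) => z; rewrite !(ipE ipP); ring.
have /andP[l0 l1] := lam01 k.+1.
apply: le_trans (ler_normD _ _) _; rewrite !normrZ (@ger0_norm _ (1 - _)) ?subr_ge0 //.
apply: lerD.
  apply: ler_wpM2l; first by rewrite subr_ge0.
  by apply: Sne; exact: halpern_iter_in.
by rewrite [leRHS]mulrC; apply: ler_wpM2l => //; exact: halpern_iter_anchor_bound.
Qed.

Lemma halpern_iter_residual (e : R) : 0 < e ->
  exists N, forall n, (N <= n)%N -> `|x n - S (x n)| <= e.
Proof.
move=> e0; have e20 : 0 < e / 2 by lra.
have K1 : 0 < 2 * K + 1 by have := K0; lra.
have [N hN] := halpern_iter_asymptotic_regularity e20.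
case: (lamP) => _ /cvg_seq_distP/(_ _ (divr_gt0 e20 K1))[M hM] _ _.
exists (maxn N M) => n; rewrite geq_max => /andP[Nn Mn].
have := hM n Mn; rewrite subr0 ler_pdivlMr //.
have /andP[l0 l1] := lam01 n; rewrite ger0_norm // => h1.
have := hN n Nn; rewrite distrC => h2.
have := ler_distD (x n.+1) (x n) (S (x n)).
have -> : x n.+1 - S (x n) = lam n *: (u - S (x n)).
  by rewrite xS; apply: (ip_ext ipP) => z; rewrite !(ipE ipP); ring.
rewrite normrZ (ger0_norm l0); have := halpern_iter_anchor_bound n.
by nra.
Qed.

Variable p : H.
Hypotheses (Dp : D p) (Sp : S p = p).
Hypothesis p_approx : forall e : R, 0 < e ->
  exists s z, browder_point s z /\ `|z - p| <= e.

(** One Browder point [z] close to [p] is enough. Its parameter [s] is fixed first, and only then is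
    [n] taken so large that the residual of [x n] is small even after division by [s]. *)
Lemma halpern_iter_limsup (e : R) : 0 < e ->
  exists N, forall n, (N <= n)%N -> ip (u - p) (x n - p) <= e.
Proof.
(* [K2] adds up the coefficients of [e'] in [h1], [h2] and [h3]. *)
move=> e0; pose K2 := 1 + 2 * `|u - q| + K + `|p - q|.
have nu0 := normr_ge0 (u - q); have np0 := normr_ge0 (p - q); have K0' := K0.
have K20 : 0 < K2 by rewrite /K2; lra.
have e'0 := divr_gt0 e0 K20; move: e'0; set e' := e / K2 => e'0.
have eE : e = e' * K2 by rewrite /e' divfK // gt_eqF.
have [s [z [zP zp]]] := p_approx e'0.
have [/andP[s0 s1] Dz _] := zP.
(* [K3] bounds [|x n - z|] through [q]; the 1 makes it positive. *)
pose K3 := K + `|u - q| + 1.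
have K30 : 0 < K3 by rewrite /K3; lra.
have [N hN] := halpern_iter_residual (divr_gt0 (mulr_gt0 s0 e'0) K30).
exists N => n /hN; rewrite ler_pdivlMr // => hr.
have Dx := halpern_iter_in n; have xb := halpern_iter_bound n.
have h1 : ip (u - z) (x n - z) <= e'.
  have : s * ip (u - z) (x n - z) <= (1 - s) * ip (x n - S (x n)) (x n - z).
    have := browder_point_ip zP Dx.
    by rewrite -(opprB (x n) z) !(ipNr ipP) !mulrN lerN2.
  have : ip (x n - S (x n)) (x n - z) <= `|x n - S (x n)| * K3.
    apply: le_trans (ip_le_norm ipP _ _) _; apply: ler_wpM2l => //.
    have := ler_distD q (x n) z; rewrite (distrC q z).
    by have := browder_point_bound zP; rewrite /K3; lra.
  have : 0 <= `|x n - S (x n)| * K3 by apply: mulr_ge0 => //; exact: ltW.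
  move: hr; set A := `|_| * _; set B := ip _ _; set C := ip _ _ => hr A0 BA h.
  have : s * C <= s * e' by nra.
  by rewrite ler_pM2l.
have h2 : ip (u - z) (z - p) <= 2 * `|u - q| * e'.
  apply: le_trans (ip_le_norm ipP _ _) _; apply: ler_pM => //.
  exact: browder_point_bound' zP.
have h3 : ip (z - p) (x n - p) <= e' * (K + `|p - q|).
  apply: le_trans (ip_le_norm ipP _ _) _; apply: ler_pM => //.
  by have := ler_distD q (x n) p; rewrite (distrC q p); lra.
have -> : ip (u - p) (x n - p) =
    ip (u - z) (x n - z) + ip (u - z) (z - p) + ip (z - p) (x n - p).
  by rewrite !(ipE ipP); ring.
by rewrite eE /K2; lra.
Qed.

(** Expanding the square yields [|x k.+1 - p| ^+ 2 <= (1 - lam k) * |x k - p| ^+ 2 + 2 * lam k * ip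
    (u - p) (x k.+1 - p)], to which the real recursion applies. *)
Lemma halpern_iter_cvg : x @ \oo --> p.
Proof.
apply/cvg_seq_distP => e e0.
have [||||||N hN] := @halpern_recursion_cvg0 _ lam (fun n => `|x n - p| ^+ 2)
  (fun n => 2 * ip (u - p) (x n.+1 - p)) (fun=> 0) lam01 _ _ _ _ _ (e ^+ 2).
- by case: lamP => _ _ /cvgryPge h _ A; have [N _ hN] := h A; exists N.
- by [].
- by move=> d d0; exists 0%N => n; rewrite big1 // ltW.
- move=> d d0; have d20 : 0 < d / 2 by lra.
  have [N hN] := halpern_iter_limsup d20; exists N => n Nn.
  by have := hN n.+1 (leqW Nn); lra.
- move=> k; rewrite addr0; have /andP[l0 l1] := lam01 k.
  have -> : x k.+1 - p = (1 - lam k) *: (S (x k) - p) + lam k *: (u - p).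
    by rewrite xS; apply: (ip_ext ipP) => z; rewrite !(ipE ipP); ring.
  have h : `|S (x k) - p| ^+ 2 <= `|x k - p| ^+ 2.
    rewrite ler_sqr ?nnegrE // -{1}Sp.
    by apply: Sne => //; exact: halpern_iter_in.
  rewrite (normD_sqr ipP) !normrZ !ger0_norm ?subr_ge0 // !exprMn.
  rewrite !(ipDr ipP) !(ipZl ipP) !(ipZr ipP) (ip_norm ipP) (ipC ipP (u - p)).
  move: h (sqr_ge0 `|u - p|) (sqr_ge0 `|S (x k) - p|).
  set a := `|S _ - _| ^+ 2; set b := `|x k - p| ^+ 2; set c := `|u - p| ^+ 2.
  set d := ip _ _; set t := lam k in l0 l1 *; move=> h c0 a0.
  have : (1 - t) * a <= (1 - t) * b by apply: ler_wpM2l; rewrite ?subr_ge0.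
  have : 0 <= t * (1 - t) * a by rewrite !mulr_ge0 ?subr_ge0.
  have : 0 <= t ^+ 2 * c by rewrite mulr_ge0 ?sqr_ge0.
  by lra.
- exact: exprn_gt0.
exists N => n /hN; rewrite ler_sqr ?nnegrE //; exact: ltW.
Qed.

End Iteration.

End Halpern.

(** * Unconditional sums with weights of total mass 1 *)

Section WeightedSums.
Variables (R : realType) (H : completeNormedModType R).
Variables (Om : set (seq nat)) (w : seq nat -> R).

Definition finsub (r : seq (seq nat)) := uniq r /\ forall t, t \in r -> Om t.

Lemma finsub_union r1 r2 : finsub r1 -> finsub r2 ->
  [/\ finsub (undup (r1 ++ r2)), {subset r1 <= undup (r1 ++ r2)} &
      {subset r2 <= undup (r1 ++ r2)}].
Proof.
move=> [_ h1] [_ h2]; split.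
- split; first exact: undup_uniq.
  by move=> t; rewrite mem_undup mem_cat => /orP[/h1|/h2].
- by move=> t ht; rewrite mem_undup mem_cat ht.
- by move=> t ht; rewrite mem_undup mem_cat ht orbT.
Qed.

Lemma sum_subset (V : zmodType) (f : seq nat -> V) (r0 r : seq (seq nat)) :
  uniq r0 -> uniq r -> {subset r0 <= r} ->
  \sum_(t <- r) f t = \sum_(t <- r0) f t + \sum_(t <- r | t \notin r0) f t.
Proof.
move=> u0 ur sub; rewrite (bigID (mem r0)) /=; congr (_ + _).
rewrite -big_filter; apply: perm_big; apply: uniq_perm => //.
  exact: filter_uniq.
by move=> t; rewrite mem_filter andb_idr //; exact: sub.
Qed.

Lemma HasSum_approx (f : seq nat -> H) s : HasSum Om f s ->
  forall e : R, 0 < e -> forall r1, finsub r1 ->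
  exists r, [/\ finsub r, {subset r1 <= r} & `|s - \sum_(t <- r) f t| < e].
Proof.
move=> h e /h[r0 [u0 O0 hr]] r1 hr1.
have [[h1 h2] h3 h4] := finsub_union (conj u0 O0) hr1.
by exists (undup (r0 ++ r1)); split => //; exact: hr.
Qed.

Lemma HasSumB (f g : seq nat -> H) s s' : HasSum Om f s -> HasSum Om g s' ->
  HasSum Om (fun t => f t - g t) (s - s').
Proof.
move=> hf hg e e0; have e20 : 0 < e / 2 by lra.
have [r1 [u1 O1 h1]] := hf _ e20; have [r2 [u2 O2 h2]] := hg _ e20.
have [[u3 O3] s1 s2] := finsub_union (conj u1 O1) (conj u2 O2).
exists (undup (r1 ++ r2)); split => // r ur Or sub.
have := h1 r ur Or (fun t ht => sub t (s1 t ht)).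
have := h2 r ur Or (fun t ht => sub t (s2 t ht)).
have -> : s - s' - \sum_(t <- r) (f t - g t) =
    (s - \sum_(t <- r) f t) - (s' - \sum_(t <- r) g t).
  by rewrite sumrB !opprB addrACA [RHS]addrACA; congr (_ + _); rewrite addrC.
have := ler_normB (s - \sum_(t <- r) f t) (s' - \sum_(t <- r) g t).
by lra.
Qed.

Lemma HasSum_norm_le (f : seq nat -> H) s (C : R) : HasSum Om f s ->
  (forall r, finsub r -> `|\sum_(t <- r) f t| <= C) -> `|s| <= C.
Proof.
move=> h hC; apply/ler_addgt0Pr => e e0.
have nil_in : finsub [::] by split.
have [r [hr _ hs]] := HasSum_approx h e0 nil_in.
have := hC _ hr; have := ler_normD (s - \sum_(t <- r) f t) (\sum_(t <- r) f t).
by rewrite subrK; lra.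
Qed.

Lemma HasSum_unique (f : seq nat -> H) s s' :
  HasSum Om f s -> HasSum Om f s' -> s = s'.
Proof.
move=> h h'; apply/eqP; rewrite -subr_eq0 -normr_le0.
apply: (HasSum_norm_le (HasSumB h h')) => r _.
by rewrite big1 ?normr0 // => t _; rewrite subrr.
Qed.

Lemma eq_HasSum (f g : seq nat -> H) s :
  (forall t, Om t -> f t = g t) -> HasSum Om f s -> HasSum Om g s.
Proof.
move=> fg h e /h[r0 [u0 O0 hr]]; exists r0; split => // r ur Or sub.
rewrite -(_ : \sum_(t <- r) f t = \sum_(t <- r) g t); first exact: hr.
by apply: eq_big_seq => t /Or/fg.
Qed.

Hypothesis w_ge0 : forall t, Om t -> 0 <= w t.
Hypothesis w_sum : (\esum_(t in Om) (w t)%:E = 1)%E.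

Lemma weight_le1 r : finsub r -> \sum_(t <- r) w t <= 1.
Proof.
move=> [ur Or]; rewrite -lee_fin -sumEFin -w_sum.
apply: esum_ge; exists [set` r].
  by split => [|t /Or//]; exact: finite_seq.
by rewrite fsbig_seq.
Qed.

Lemma weight_approx (e : R) : 0 < e ->
  exists2 r, finsub r & 1 - e < \sum_(t <- r) w t.
Proof.
move=> e0; have : ((1 - e)%:E < \esum_(t in Om) (w t)%:E)%E.
  by rewrite w_sum lte_fin; lra.
move=> /ereal_sup_gt[_ [A [finA AOm] <-]].
rewrite fsbig_finite // sumEFin lte_fin => h.
exists (finmap.enum_fset (fset_set A)) => //; split.
  exact: finmap.fset_uniq.
by move=> t; rewrite in_fset_set // inE => /AOm.
Qed.

Section Bounded.
Variables (g : seq nat -> H) (M : R).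
Hypothesis gM : forall t, Om t -> `|g t| <= M.

Lemma weighted_norm_le r (P : pred (seq nat)) : (forall t, t \in r -> Om t) ->
  `|\sum_(t <- r | P t) w t *: g t| <= M * \sum_(t <- r | P t) w t.
Proof.
move=> Or; apply: le_trans (ler_norm_sum _ _ _) _.
rewrite mulr_sumr big_seq_cond [leRHS]big_seq_cond.
apply: ler_sum => t /andP[/Or Ot _].
by rewrite normrZ ger0_norm ?w_ge0 // mulrC ler_wpM2r ?w_ge0 // gM.
Qed.

(** The indices outside [r0] carry at most the mass that [r0] misses. *)
Lemma weighted_diff_le r0 r : 0 <= M -> finsub r0 -> finsub r -> {subset r0 <= r} ->
  `|\sum_(t <- r) w t *: g t - \sum_(t <- r0) w t *: g t| <=
  M * (1 - \sum_(t <- r0) w t).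
Proof.
move=> M0 [u0 O0] hr sub; have [ur Or] := hr.
rewrite (sum_subset _ u0 ur sub) addrAC subrr add0r.
apply: le_trans (weighted_norm_le _ Or) _; apply: ler_wpM2l => //.
by have := weight_le1 hr; rewrite (sum_subset _ u0 ur sub); lra.
Qed.

(** Choose finite sets whose missing mass tends to 0. Any two of their partial sums are compared
    through the union, so they form a Cauchy sequence. *)
Lemma weighted_HasSum_exists : 0 <= M ->
  exists s, HasSum Om (fun t => w t *: g t) s.
Proof.
move=> M0.
have /choice[r_ hr_] : forall n : nat, exists r,
    finsub r /\ 1 - n.+1%:R^-1 < \sum_(t <- r) w t.
  move=> n; have n0 : 0 < (n.+1%:R : R)^-1 by rewrite invr_gt0 ltr0n.
  by have [r ? ?] := weight_approx n0; exists r.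
pose v n := \sum_(t <- r_ n) w t *: g t.
have small (e : R) : 0 < e -> exists N, forall n, (N <= n)%N ->
    M * (1 - \sum_(t <- r_ n) w t) <= e.
  move=> e0; have M1 : 0 < M + 1 by lra.
  have [N hN] := (cvg_seq_distP _ _).1 (@cvg_harmonic R) _ (divr_gt0 e0 M1).
  exists N => n /hN; rewrite /harmonic subr0 ger0_norm ?invr_ge0 // ler_pdivlMr //.
  have [hr hw] := hr_ n.
  have : 0 < (n.+1%:R : R)^-1 by rewrite invr_gt0 ltr0n.
  have : M * (1 - \sum_(t <- r_ n) w t) <= M * n.+1%:R^-1.
    by apply: ler_wpM2l => //; rewrite lerBlDr -lerBlDl ltW.
  by move=> + + /=; move: (n.+1%:R^-1) => i; lra.
have [s vs] : exists s : H, v @ \oo --> s.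
  apply: cauchy_seq_cvg => e e0; have e20 : 0 < e / 2 by lra.
  have [N hN] := small _ e20; exists N => m n /hN hm /hN hn.
  have [h1 h2 h3] := finsub_union (hr_ m).1 (hr_ n).1.
  have := weighted_diff_le M0 (hr_ m).1 h1 h2.
  have := weighted_diff_le M0 (hr_ n).1 h1 h3.
  rewrite -/(v m) -/(v n); set U := \sum_(t <- undup _) _.
  by have := ler_distD U (v m) (v n); rewrite (distrC (v m) U); lra.
exists s => e e0; have e20 : 0 < e / 3 by lra.
have [N1 hN1] := small _ e20; have [N2 hN2] := (cvg_seq_distP _ _).1 vs _ e20.
pose n := maxn N1 N2.
have := hN1 n (leq_maxl _ _); have := hN2 n (leq_maxr _ _) => h1 h2.
have [un On] := (hr_ n).1.
exists (r_ n); split => // r ur Or sub.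
have := weighted_diff_le M0 (hr_ n).1 (conj ur Or) sub.
rewrite -/(v n); set U := \sum_(t <- r) _.
by have := ler_distD (v n) s U; rewrite (distrC s (v n)) (distrC (v n) U); lra.
Qed.

End Bounded.

Lemma weighted_HasSum_cst (c : H) : HasSum Om (fun t => w t *: c) c.
Proof.
move=> e e0; have c1 : 0 < `|c| + 1 by have := normr_ge0 c; lra.
have [r [ur Or] hr] := weight_approx (divr_gt0 e0 c1).
exists r; split => // r' ur' Or' sub.
have hW := weight_le1 (conj ur' Or').
have : \sum_(t <- r) w t <= \sum_(t <- r') w t.
  rewrite (sum_subset _ ur ur' sub) lerDl big_seq_cond sumr_ge0 //.
  by move=> t /andP[/Or'/w_ge0].
move: hW hr; rewrite -scaler_suml; set W := \sum_(t <- r') w t.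
rewrite -{2}(scale1r c) -scalerBl normrZ => hW hr hWW.
rewrite ger0_norm ?subr_ge0 //.
have : 1 - W < e / (`|c| + 1) by lra.
rewrite ltr_pdivlMr //; have := normr_ge0 c; nra.
Qed.

Lemma weighted_HasSumB (g : seq nat -> H) s c :
  HasSum Om (fun t => w t *: g t) s ->
  HasSum Om (fun t => w t *: (g t - c)) (s - c).
Proof.
move=> h; apply: eq_HasSum (HasSumB h (weighted_HasSum_cst c)) => t _ /=.
by rewrite scalerBr.
Qed.

Lemma weighted_HasSum_dist_le (f g : seq nat -> H) s s' (C : R) :
  HasSum Om (fun t => w t *: f t) s -> HasSum Om (fun t => w t *: g t) s' ->
  0 <= C -> (forall t, Om t -> `|f t - g t| <= C) -> `|s - s'| <= C.
Proof.
move=> hf hg C0 hC; apply: (HasSum_norm_le (HasSumB hf hg)) => r hr.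
under eq_bigr do rewrite -scalerBr.
apply: le_trans (weighted_norm_le hC _ hr.2) _.
by rewrite -[leRHS]mulr1; apply: ler_wpM2l => //; exact: weight_le1.
Qed.

(* The missing mass 1 - sum_r w is put on c; adjoining t to r moves c towards g t. *)
Lemma convex_subset_sum (D : set H) (g : seq nat -> H) (r : seq (seq nat)) c :
  convex_subset D -> (forall t, t \in r -> 0 <= w t /\ D (g t)) ->
  \sum_(t <- r) w t <= 1 -> D c -> D (c + \sum_(t <- r) w t *: (g t - c)).
Proof.
move=> cvD; elim: r c => [|t r IH] c h; first by rewrite !big_nil addr0.
rewrite !big_cons => W1 Dc.
have [wt0 Dt] := h t (mem_head _ _).
have h' t' : t' \in r -> 0 <= w t' /\ D (g t').
  by move=> t'r; apply: h; rewrite inE t'r orbT.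
move: W1; set W := \sum_(t <- r) w t => W1.
(* If [W = 1] then [w t = 0], and the convention that division by 0 gives 0 makes [a = 0], so [aE]
   still holds. *)
pose a := w t / (1 - W).
have aE : (1 - W) * a = w t.
  rewrite /a; have [W0|W0] := eqVneq (1 - W) 0; last by rewrite mulrCA divff ?mulr1.
  by rewrite W0 mul0r; apply/eqP; rewrite eq_le wt0 /=; lra.
have a0 : 0 <= a by rewrite divr_ge0 //; lra.
have a1 : a <= 1.
  have [W0|W0] := eqVneq (1 - W) 0; first by rewrite /a W0 invr0 mulr0.
  rewrite ler_pdivrMr ?mul1r; first by lra.
  by rewrite lt_neqAle eq_sym W0 /=; lra.
have := IH (a *: g t + (1 - a) *: c) h' _ (cvD _ _ _ Dt Dc a0 a1).
have sumE (z : H) : \sum_(t <- r) w t *: (g t - z) =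
    \sum_(t <- r) w t *: g t - W *: z.
  by rewrite /W scaler_suml -sumrB; apply: eq_bigr => t2 _; rewrite scalerBr.
rewrite !sumE => /(_ (le_trans _ W1)); rewrite lerDr => /(_ wt0).
congr D; set G := \sum_(t <- r) _.
have -> : a *: g t + (1 - a) *: c = c + a *: (g t - c).
  by rewrite scalerBl scale1r scalerBr addrCA.
rewrite -aE; move: (a) => b.
rewrite -scalerA scalerBl scale1r (scalerDr W) opprD.
by rewrite -addrA; congr (_ + _); rewrite [G + _]addrA addrA [RHS]addrAC.
Qed.

(** Finite partial sums may have mass below 1 and leave [D]. Centred at [c] they become points of
    [D] by [convex_subset_sum], and closedness gives the limit. *)
Lemma weighted_HasSum_in (D : set H) (g : seq nat -> H) s c :
  closed D -> convex_subset D -> D c -> (forall t, Om t -> D (g t)) ->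
  HasSum Om (fun t => w t *: g t) s -> D s.
Proof.
move=> cD cvD Dc Dg /(weighted_HasSumB c) hs; apply: closed_approx => // e e0.
have nil_in : finsub [::] by split.
have [r [hr _ h]] := HasSum_approx hs e0 nil_in.
exists (c + \sum_(t <- r) w t *: (g t - c)); last by rewrite opprD addrA.
apply: convex_subset_sum => //; last exact: weight_le1.
by move=> t /hr.2 Ot; split; [exact: w_ge0|exact: Dg].
Qed.

(** By Cauchy-Schwarz the deficits [|x| ^+ 2 - ip (g t) x] are nonnegative, while their weighted sum
    is 0. So each vanishes, and with [|g t| <= |x|] this forces [g t = x]. *)
Lemma weighted_HasSum_extremal (ip : H -> H -> R) (g : seq nat -> H) x :
  inner_product_of_norm ip -> (forall t, Om t -> 0 < w t) ->
  (forall t, Om t -> `|g t| <= `|x|) -> HasSum Om (fun t => w t *: g t) x ->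
  forall t, Om t -> g t = x.
Proof.
move=> ipP w0 gx hs t Ot.
have d_ge0 t' : Om t' -> 0 <= `|x| ^+ 2 - ip (g t') x.
  move=> /gx h; have := ip_le_norm ipP (g t') x; have := normr_ge0 x; nra.
have d_le0 : w t * (`|x| ^+ 2 - ip (g t) x) <= 0.
  apply: (@le0_of_le_eps _ `|x|) => // e e0.
  have t_in : finsub [:: t] by split => // t'; rewrite inE => /eqP ->.
  have [r [hr sub h]] := HasSum_approx hs e0 t_in.
  have tr : t \in r by apply: sub; rewrite inE.
  (* The single deficit is at most the sum over [r], which contains [t]. Since [r] has mass at most
     1, that sum is at most [ip (x - \sum_(t <- r) w t *: g t) x]. *)
  apply: (@le_trans _ _ (\sum_(t <- r) w t * (`|x| ^+ 2 - ip (g t) x))).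
    rewrite (big_rem t) //= lerDl big_seq sumr_ge0 // => t' /mem_rem /hr.2 Ot'.
    by rewrite mulr_ge0 ?d_ge0 ?w_ge0.
  have -> : \sum_(t <- r) w t * (`|x| ^+ 2 - ip (g t) x) =
      (\sum_(t <- r) w t) * `|x| ^+ 2 - ip (\sum_(t <- r) w t *: g t) x.
    rewrite (ip_suml ipP) mulr_suml -sumrB; apply: eq_bigr => t' _.
    by rewrite (ipZl ipP) mulrBr.
  have := ip_le_norm ipP (x - \sum_(t <- r) w t *: g t) x.
  rewrite (ipBl ipP) (ip_norm ipP).
  have := weight_le1 hr; have := sqr_ge0 `|x|; have := normr_ge0 x.
  move: h; set A := `|x - _|; set B := ip _ _; set W := \sum_(t <- r) w t.
  nra.
have ipx : `|x| ^+ 2 <= ip (g t) x.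
  by move: d_le0; rewrite pmulr_rle0 ?w0 // subr_le0.
apply/eqP; rewrite -subr_eq0 -normr_le0 -(@ler_sqr _ _ 0) ?nnegrE // expr0n /=.
rewrite (normB_sqr ipP).
have : `|g t| ^+ 2 <= `|x| ^+ 2 by rewrite ler_sqr ?nnegrE // gx.
by lra.
Qed.

End WeightedSums.

(** * Strings of firmly nonexpansive operators *)

Section StringOperators.
Variables (R : realType) (H : normedModType R) (ip : H -> H -> R).
Variables (D : set H) (I : set nat) (T : nat -> H -> H).
Hypothesis ipP : inner_product_of_norm ip.
Hypothesis TD : forall i, I i -> forall x, D x -> D (T i x).
Hypothesis Tfne : forall i, I i -> firmly_nonexpansive_on ip D (T i).

Lemma firmly_nonexpansive_nonexpansive i x y : I i -> D x -> D y ->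
  `|T i x - T i y| <= `|x - y|.
Proof.
move=> Ii Dx Dy; have h := Tfne Ii Dx Dy.
have := le_trans h (ip_le_norm ipP _ _); rewrite expr2.
have [->|T0] := eqVneq `|T i x - T i y| 0; first by rewrite normr_ge0.
by rewrite ler_pM2r // lt_neqAle eq_sym T0 normr_ge0.
Qed.

Lemma string_op_in t x : (forall i, i \in t -> I i) -> D x -> D (string_op T t x).
Proof.
elim: t x => [|i t IH] x // h Dx; apply: IH => [j jt|].
  by apply: h; rewrite inE jt orbT.
by apply: TD => //; apply: h; rewrite mem_head.
Qed.

Lemma string_op_nonexpansive t x y : (forall i, i \in t -> I i) -> D x -> D y ->
  `|string_op T t x - string_op T t y| <= `|x - y|.
Proof.
elim: t x y => [|i t IH] x y // h Dx Dy.
have Ii : I i by apply: h; rewrite mem_head.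
have h' j : j \in t -> I j by move=> jt; apply: h; rewrite inE jt orbT.
apply: le_trans (IH _ _ h' (TD Ii Dx) (TD Ii Dy)) _.
exact: firmly_nonexpansive_nonexpansive.
Qed.

Lemma string_op_fix t x : (forall i, i \in t -> T i x = x) -> string_op T t x = x.
Proof.
elim: t => [|i t IH] // h; rewrite /string_op /= h ?mem_head //.
by apply: IH => j jt; apply: h; rewrite inE jt orbT.
Qed.

(** Firm nonexpansiveness gives [|T i x - x| ^+ 2 <= |x - q| ^+ 2 - |T i x - q| ^+ 2]. *)
Lemma firmly_nonexpansive_fix i x q : I i -> D x -> D q -> T i q = q ->
  `|x - q| <= `|T i x - q| -> T i x = x.
Proof.
move=> Ii Dx Dq Tq hx; have := Tfne Ii Dx Dq; rewrite Tq => h.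
apply/eqP; rewrite -subr_eq0 -normr_le0 -(@ler_sqr _ _ 0) ?nnegrE // expr0n /=.
have -> : T i x - x = (T i x - q) - (x - q) by rewrite opprB addrA subrK.
rewrite (normB_sqr ipP) (ipC ipP).
have : `|x - q| ^+ 2 <= `|T i x - q| ^+ 2 by rewrite ler_sqr ?nnegrE.
by lra.
Qed.

(** The tail of the string cannot increase the distance to [q], so the first operator already
    preserves it and fixes [x]. The tail then starts again from [x]. *)
Lemma string_op_dist_fix t x q : (forall i, i \in t -> I i) -> D x -> D q ->
  (forall i, I i -> T i q = q) -> `|x - q| <= `|string_op T t x - q| ->
  forall i, i \in t -> T i x = x.
Proof.
elim: t => [|i t IH] // h Dx Dq Tq hx.
have Ii : I i by apply: h; rewrite mem_head.
have h' j : j \in t -> I j by move=> jt; apply: h; rewrite inE jt orbT.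
have Tix : T i x = x.
  apply: (@firmly_nonexpansive_fix _ _ q) => //; first exact: Tq.
  apply: le_trans hx _; rewrite -{1}(string_op_fix (fun j jt => Tq j (h' j jt))).
  exact: string_op_nonexpansive (TD Ii Dx) Dq.
move=> j; rewrite inE => /orP[/eqP -> //|].
by apply: IH => //; move: hx; rewrite /string_op /= Tix.
Qed.

End StringOperators.

(** * Convergence of the string-averaging iteration *)

Theorem theorem8 (R : realType) (H : completeNormedModType R)
  (ip : H -> H -> R) (D : set H) (I : set nat) (T : nat -> H -> H)
  (Om : set (seq nat)) (w : seq nat -> R) (lam : nat -> R) (u x0 : H) :
  inner_product_of_norm ip ->
  D !=set0 -> closed D -> convex_subset D ->
  (forall i, I i -> (0 < i)%N) ->
  (forall i, I i -> forall x, D x -> D (T i x)) ->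
  (forall i, I i -> firmly_nonexpansive_on ip D (T i)) ->
  let F := [set x | D x /\ forall i, I i -> T i x = x] in
  F !=set0 ->
  M_infty I Om w ->
  steering lam ->
  D u -> D x0 ->
  let is_iter (x : nat -> H) :=
    x 0%N = x0 /\
    forall k, exists s, HasSum Om (fun t => w t *: string_op T t (x k)) s /\
      x k.+1 = lam k *: u + (1 - lam k) *: s in
  (exists x, is_iter x /\ forall k, D (x k)) /\
  (exists p, metric_projection F u p) /\
  forall x p, is_iter x -> metric_projection F u p -> x @ \oo --> p.
Proof.
move=> ipP _ cD cvD _ TD Tfne F [q [Dq Tq]] [[Om_vec Om_fit] w01 w1] lamP Du Dx0.
move=> is_iter.
have OmI t : Om t -> forall i, i \in t -> I i by move=> /Om_vec[].
have w_gt0 t (Ot : Om t) : 0 < w t := (w01 t Ot).1.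
have w_ge0 t (Ot : Om t) : 0 <= w t := ltW (w_gt0 t Ot).
have string_fix t y : Om t -> (forall i, I i -> T i y = y) -> string_op T t y = y.
  by move=> Ot Ty; apply: string_op_fix => i /(OmI _ Ot)/Ty.
have string_dist t y z : Om t -> D y -> D z ->
    `|string_op T t y - string_op T t z| <= `|y - z|.
  by move=> Ot Dy Dz; apply: (string_op_nonexpansive ipP TD Tfne (OmI t Ot)).
pose g y t := w t *: string_op T t y.
have sum_ex y : D y -> exists s, HasSum Om (g y) s.
  (* All strings fix [q], so each [string_op T t y] lies within [|y - q|] of [q]. *)
  move=> Dy; apply: (@weighted_HasSum_exists _ _ _ _ w_ge0 w1 _ (`|y - q| + `|q|)).
    move=> t Ot; have := string_dist t y q Ot Dy Dq; rewrite (string_fix t q) //.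
    by have := ler_normD (string_op T t y - q) q; rewrite subrK; lra.
  exact: addr_ge0.
(* The default [y] is irrelevant on [D], where the sum exists. *)
pose S y := xget y [set s | HasSum Om (g y) s].
have S_eq y s : HasSum Om (g y) s -> s = S y.
  move=> hs; apply: (HasSum_unique hs).
  exact: (@xgetPex _ y [set s | HasSum Om (g y) s] (ex_intro _ s hs)).
have S_sum y : D y -> HasSum Om (g y) (S y).
  by move=> /sum_ex[s hs]; rewrite -(S_eq _ _ hs).
have SD y : D y -> D (S y).
  move=> Dy; apply: (weighted_HasSum_in w_ge0 w1 cD cvD Du _ (S_sum y Dy)).
  by move=> t Ot; exact: (string_op_in TD (OmI t Ot) Dy).
have Sne y z : D y -> D z -> `|S y - S z| <= `|y - z|.
  move=> Dy Dz; apply: (weighted_HasSum_dist_le w_ge0 w1 (S_sum y Dy) (S_sum z Dz)).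
    exact: normr_ge0.
  by move=> t Ot; exact: string_dist.
have S_fix y : F y -> S y = y.
  move=> [Dy Ty]; symmetry; apply: S_eq.
  apply: eq_HasSum (weighted_HasSum_cst w_ge0 w1 y) => t Ot.
  by rewrite /g string_fix.
have fix_S y : D y -> S y = y -> F y.
  move=> Dy Sy; split=> // i /Om_fit[t [Ot it]].
  (* Centred at [q], the vector [y - q] is the weighted sum of vectors no longer than itself, which
     is the extremal case. *)
  have hs := weighted_HasSumB w_ge0 w1 q (S_sum y Dy); rewrite Sy in hs.
  have dist_le t' : Om t' -> `|string_op T t' y - q| <= `|y - q|.
    by move=> Ot'; have := string_dist t' y q Ot' Dy Dq; rewrite (string_fix t' q).
  have ty := weighted_HasSum_extremal w_ge0 w1 ipP w_gt0 dist_le hs Ot.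
  by apply: (string_op_dist_fix ipP TD Tfne (OmI t Ot) Dy Dq Tq) it; rewrite ty.
have Sq : S q = q by exact: S_fix.
have [p [Dp Sp p_var p_approx]] := browder_limit ipP cD cvD SD Sne Du Dq Sq.
have Fp : F p by exact: fix_S.
(* This sharpened inequality gives both the minimality of [p] and the uniqueness of the
   projection. *)
have p_dist y : F y -> `|u - p| ^+ 2 + `|p - y| ^+ 2 <= `|u - y| ^+ 2.
  move=> Fy; have := p_var y Fy.1 (S_fix y Fy).
  have -> : u - y = (u - p) + (p - y) by rewrite addrA subrK.
  by rewrite (normD_sqr ipP (u - p)); lra.
split; [|split].
- pose x := nat_rect (fun=> H) x0 (fun k y => lam k *: u + (1 - lam k) *: S y).
  have Dx k : D (x k) by exact: (halpern_iter_in cvD SD Du lamP).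
  exists x; split=> //; split=> // k; exists (S (x k)); split=> //.
  exact: S_sum.
- exists p; split=> // y /p_dist; have := sqr_ge0 `|p - y| => h1 h2.
  by rewrite -ler_sqr ?nnegrE //; lra.
move=> x p' [x0E xE] [Fp' p'_min].
have -> : p' = p.
  apply/eqP; rewrite eq_sym -subr_eq0 -normr_le0 -(@ler_sqr _ _ 0) ?nnegrE //.
  have : `|u - p'| ^+ 2 <= `|u - p| ^+ 2 by rewrite ler_sqr ?nnegrE // p'_min.
  rewrite expr0n /=.
  by have := p_dist p' Fp'; lra.
have Dx : D (x 0%N) by rewrite x0E.
apply: (halpern_iter_cvg ipP cvD SD Sne Du Dq Sq lamP Dx _ Dp Sp p_approx).
(* Uniqueness of sums identifies any admissible [s] with [S (x k)]. *)
by move=> k; have [s [/S_eq -> ->]] := xE k.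
Qed.
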